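(* (Geometrical Affection Principle) Let $\Gamma$ be a finite connected loose graph, let $xy$ be an edge on the (distinct) vertices $x$ and $y$, and let $k$ be any finite field. The difference between the number of $k$-points of $\mathcal F(\Gamma)\otimes_{\mathbb F_1}k$ and that of $\mathcal F(\Gamma_{xy})\otimes_{\mathbb F_1}k$ is $$\bigl|\mathcal F(\Gamma_{|\mathbf P_{x,y}})\otimes_{\mathbb F_1}k\bigr|_k-\bigl|\mathcal F({\Gamma_{xy}}_{|\mathbf P_{x,y}})\otimes_{\mathbb F_1}k\bigr|_k .$$ In this expression, $\Gamma$ may be replaced by its reduced graph before resolving $xy$ (but after resolving $xy$ one does not reduce $\Gamma_{xy}$).
   Context: A loose graph is a triple $(V,E,\mathbf I)$ of vertices, edges and a symmetric incidence relation between vertices and edges such that each edge is incident with at most two distinct vertices (so an edge may have two, one or no vertices); no loops, undirected. Edges with fewer than two vertices are called loose; the reduced graph of $\Gamma$ is $\Gamma$ with all its loose edges deleted. Ambient space: let $\overline\Gamma$ be the graph obtained from $\Gamma$ by adding a second, new vertex to each edge having only one vertex (and two new vertices to each edge having none), with vertex set $\overline V$; $\mathbf P(\Gamma)\otimes_{\mathbb F_1}k$ is the projective space over $k$ with one homogeneous coordinate $X_w$ for each $w\in\overline V$. For $v\in V$, $\mathbb A_v$ is the affine space of dimension $\deg(v)$ given by $X_v\ne0$ and $X_w=0$ for every $w\in\overline V\setminus\{v\}$ not adjacent to $v$ in $\overline\Gamma$. An edge with no vertices gives a multiplicative group (both added-end coordinates nonzero, all others $0$). $\mathcal F(\Gamma)\otimes_{\mathbb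 F_1}k$ is the union of all these pieces; $|\cdot|_k$ denotes the number of $k$-points. Resolution: $\Gamma_{xy}$ is the loose graph obtained from $\Gamma$ by deleting the edge $xy$ and adding two new loose edges, one incident only with $x$ and one incident only with $y$. With $\mathrm d$ the graph distance in $\Gamma$ and $\overline{\mathbf B}(c,1)=\{v\in V\mid\mathrm d(c,v)\le1\}$, $\mathbf P_{x,y}$ is the projective space generated by $\overline{\mathbf B}(x,1)\cup\overline{\mathbf B}(y,1)$ (distances taken in $\Gamma$), and $\Gamma_{|\mathbf P_{x,y}}$ is the graph induced by $\Gamma$ on these vertices; ${\Gamma_{xy}}_{|\mathbf P_{x,y}}$ is the loose graph induced by $\Gamma_{xy}$ on the same vertices, including the two new loose edges at $x$ and $y$. *)

(* Defs.v *)
From mathcomp Require Import all_boot all_order all_algebra.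

Set Implicit Arguments.
Unset Strict Implicit.
Unset Printing Implicit Defensive.

Import GRing.Theory.
Local Open Scope ring_scope.

(* The symmetric incidence relation between vertices and edges is stored as a
   boolean predicate on vertex-edge pairs. *)
Record loose_graph := LooseGraph {
  vert : finType;
  edge : finType;
  inc : vert -> edge -> bool;
  inc_le2 : forall e, (#|[set v | inc v e]| <= 2)%N }.

Definition ends (G : loose_graph) (e : edge G) : {set vert G} :=
  [set v | inc v e].

Definition loose (G : loose_graph) (e : edge G) : bool := (#|ends e| < 2)%N.

Definition edge_on (G : loose_graph) (e : edge G) (x y : vert G) : bool :=
  (x != y) && (ends e == [set x; y]).

Definition simple_graph (G : loose_graph) : Prop :=
  forall e f : edge G, ~~ loose e -> ends e = ends f -> e = f.

Definition adj (G : loose_graph) : rel (vert G) :=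
  fun u v => (u != v) && [exists e, inc u e && inc v e].

(* Connectedness of the incidence graph on vertices and edges together, so that
   an edge without vertices is a connected component by itself. *)
Definition inc_rel (G : loose_graph) : rel (vert G + edge G) :=
  fun a b => match a, b with
             | inl v, inr e | inr e, inl v => inc v e
             | _, _ => false
             end.

Definition connected_graph (G : loose_graph) : bool :=
  [forall a, forall b, connect (@inc_rel G) a b].

(* Minimal length of a path; the value is #|vert G| when there is no path
   (the distance between vertices joined by a path is at most #|vert G| - 1). *)
Definition gdist (G : loose_graph) (u v : vert G) : nat :=
  find (fun n => [exists p : n.-tuple (vert G),
                    path (@adj G) u p && (last u p == v)])
       (iota 0 #|vert G|).

Definition cball (G : loose_graph) (c : vert G) (r : nat) : {set vert G} :=
  [set v | (gdist c v <= r)%N].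

Lemma ends_le2 (G : loose_graph) (e : edge G) : (#|ends e| <= 2)%N.
Proof. exact: inc_le2. Qed.

Section Completion.
Variable G : loose_graph.

(* 2 - #|ends e| new vertices for every edge e *)
Definition added_vert : finType := {e : edge G & 'I_(2 - #|ends e|)}.

Definition completion_inc (w : vert G + added_vert) (e : edge G) : bool :=
  match w with
  | inl v => inc v e
  | inr a => tag a == e
  end.

Lemma completion_le2 e : (#|[set w | completion_inc w e]| <= 2)%N.
Proof.
have -> : [set w | completion_inc w e] =
    [set inl v | v in ends e] :|:
    [set inr (Tagged (fun f => 'I_(2 - #|ends f|)) i) | i : 'I_(2 - #|ends e|)].
  apply/setP=> -[v|[f i]]; rewrite !inE /=.
    apply/idP/orP=> [ve|[/imsetP[u ue [->]]|/imsetP[i _ //]]].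
      by left; apply/imsetP; exists v; rewrite ?inE.
    by rewrite inE in ue.
  apply/eqP/orP=> [fe|[/imsetP[//]|/imsetP[j _ h]]].
    by right; case: e / fe; apply/imsetP; exists i.
  exact: (congr1 (fun w => if w is inr a then tag a else f) h).
apply: leq_trans (leq_card_setU _ _) _.
apply: leq_trans (leq_add (leq_imset_card _ _) (leq_imset_card _ _)) _.
by rewrite card_ord subnKC // ends_le2.
Qed.

Definition completion : loose_graph :=
  @LooseGraph (vert G + added_vert)%type (edge G) completion_inc completion_le2.

End Completion.

Section Points.
Variables (k : finFieldType) (G : loose_graph).

(* The k-points of P(G) are the classes [proj_pt X] with X != 0. *)
Definition coords : finType := {ffun vert (completion G) -> k}.

Definition proj_pt (X : coords) : {set coords} :=
  [set [ffun w => c * X w] | c : k & c != 0].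

Definition affine_piece (v : vert G) : {set {set coords}} :=
  let v' : vert (completion G) := inl v in
  [set proj_pt X | X : coords &
     (X v' != 0) && [forall w, (w != v') && ~~ adj v' w ==> (X w == 0)]].

Definition torus_piece (e : edge G) : {set {set coords}} :=
  [set proj_pt X | X : coords &
     [forall w, (X w != 0) == @inc (completion G) w e]].

Definition F_points : {set {set coords}} :=
  (\bigcup_(v : vert G) affine_piece v) :|:
  (\bigcup_(e : edge G | ends e == set0) torus_piece e).

Definition nb_points : nat := #|F_points|.

End Points.

Section Resolution.
Variables (G : loose_graph) (e : edge G) (x y : vert G).

Definition resolve_inc (v : vert G) (f : {f : edge G | f != e} + bool) : bool :=
  match f with
  | inl f => inc v (val f)
  | inr true => v == x
  | inr false => v == y
  end.

Lemma resolve_le2 f : (#|[set v | resolve_inc v f]| <= 2)%N.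
Proof.
case: f => [f|[]] /=; first exact: inc_le2.
  by rewrite (_ : [set v | _] = [set x]) ?cards1 //; apply/setP=> v; rewrite !inE.
by rewrite (_ : [set v | _] = [set y]) ?cards1 //; apply/setP=> v; rewrite !inE.
Qed.

(* To be used when e is an edge on x and y *)
Definition resolve : loose_graph :=
  @LooseGraph (vert G) ({f : edge G | f != e} + bool)%type
    resolve_inc resolve_le2.

End Resolution.

Section Induced.
Variables (G : loose_graph) (S : {set vert G}).

(* An edge is kept when all its vertices are in S: loose edges at vertices of S
   are kept, and an edge with just one of its two vertices in S is dropped. *)
Definition induced_inc (v : {v : vert G | v \in S})
    (e : {e : edge G | ends e \subset S}) : bool := inc (val v) (val e).

Lemma induced_le2 e : (#|[set v | induced_inc v e]| <= 2)%N.
Proof.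
apply: leq_trans (ends_le2 (val e)).
rewrite -(card_imset _ val_inj); apply/subset_leq_card/subsetP=> u.
by case/imsetP=> v; rewrite !inE => ve ->.
Qed.

Definition induced : loose_graph :=
  @LooseGraph {v : vert G | v \in S} {e : edge G | ends e \subset S}
    induced_inc induced_le2.

End Induced.

Section Reduced.
Variable G : loose_graph.

Definition reduced_inc (v : vert G) (e : {e : edge G | ~~ loose e}) : bool :=
  inc v (val e).

Lemma reduced_le2 e : (#|[set v | reduced_inc v e]| <= 2)%N.
Proof. exact: inc_le2. Qed.

Definition reduced : loose_graph :=
  @LooseGraph (vert G) {e : edge G | ~~ loose e} reduced_inc reduced_le2.

Lemma edge_on_nonloose (e : edge G) (x y : vert G) :
  edge_on e x y -> ~~ loose e.
Proof. by case/andP=> xy /eqP exy; rewrite /loose exy cards2 xy. Qed.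

Definition reduced_edge (e : edge G) (x y : vert G) (exy : edge_on e x y) :
  edge reduced := exist _ e (edge_on_nonloose exy).

End Reduced.

(* The vertices generating the projective space P_{x,y} *)
Definition Pxy (G : loose_graph) (x y : vert G) : {set vert G} :=
  cball x 1 :|: cball y 1.

(* Main.v *)
(* Let q = #|k|. When no edge is empty, a k-point is a class of vectors whose
   support s lies in the closed neighbourhood, in the completion, of some vertex
   v of s; there are (q - 1) ^ #|s| vectors with support s. A support made of
   original vertices only is a set A "star-like" at one of its vertices; a
   support meeting the added vertices has a unique centre. Hence
     (q - 1) * nb_points = \sum_(A star-like) (q - 1) ^ #|A|
                           + \sum_v (q - 1) * q ^ n_v * (q ^ l_v - 1),
   with n_v the number of neighbours and l_v the number of loose edges at v.
   Resolving xy changes neither the star-likeness of sets that are not contained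
   in P_{x,y} nor the second sum away from x and y, and at x and y the
   numbers n_v and l_v are already those of the induced graphs: the difference
   is local. For a simple graph, resolution turns (n_v, l_v) into
   (n_v - 1, l_v + 1) at x and y, and q ^ n * (q ^ l - 1) -
   q ^ (n - 1) * (q ^ (l + 1) - 1) does not depend on l: the old loose edges
   do not contribute. *)
Require Import Defs.
From mathcomp Require Import all_boot all_order all_algebra.
From mathcomp Require Import ring zify.
Set Implicit Arguments.
Unset Strict Implicit.
Unset Printing Implicit Defensive.
Import GRing.Theory.
Local Open Scope ring_scope.

(** * Star-like sets and their weighted sums *)

Section StarSums.
Variables (V : finType) (t : int).
Implicit Types (r : rel V) (l : V -> nat) (A B : {set V}).

Definition nbrs r v : {set V} := [set w | r v w].

Definition starlike r A := [exists v in A, A \subset v |: nbrs r v].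

(** With [t = q - 1], this counts the vectors with a nonzero coordinate at the centre, arbitrary
    ones at its [n] neighbours, and not all zero at its [m] loose ends. *)
Definition loose_term n m : int := t * (1 + t) ^+ n * ((1 + t) ^+ m - 1).

(** With [q = 1 + t], both sides equal [t * q ^ n * (1 - q)]. *)
Lemma loose_term_resolve n m :
  loose_term n.+1 m - loose_term n m.+1 =
  loose_term n.+1 0 - loose_term n 1.
Proof.
rewrite /loose_term expr1 expr0 !exprS.
by move: ((1 + t) ^+ n) ((1 + t) ^+ m) => a b; ring.
Qed.

Definition star_count r l : int :=
  \sum_(A | starlike r A) t ^+ #|A| + \sum_v loose_term #|nbrs r v| (l v).

End StarSums.

Lemma sum_subsets (T : finType) (t : int) (L : {set T}) :
  \sum_(B : {set T} | B \subset L) t ^+ #|B| = (1 + t) ^+ #|L|.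
Proof.
rewrite -[RHS]prodr_const.
(* The factor [0 + 1] outside [L] kills, in the expanded product, every subset not contained in
   [L]. *)
have -> : \prod_(i in L) (1 + t) = \prod_i ((if i \in L then t else 0) + 1).
  by rewrite big_mkcond; apply: eq_bigr => i _; case: ifP; rewrite ?add0r // addrC.
rewrite bigA_distr big_mkcond; apply: eq_bigr => B _ /=.
case: ifPn => [sBL|/subsetPn[b bB bL]]; last first.
  by rewrite (bigD1 b) //= bB (negbTE bL) mul0r.
rewrite -prodr_const big_mkcond; apply: eq_bigr => i _.
by case: ifP => // iB; rewrite (subsetP sBL).
Qed.

(** Removing [v] leaves an arbitrary subset of [L], which accounts for the factor [t]. *)
Lemma sum_subsets_mem (T : finType) (t : int) (v : T) (L : {set T}) :
  v \notin L ->
  \sum_(B : {set T} | (v \in B) && (B \subset v |: L)) t ^+ #|B| =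
  t * (1 + t) ^+ #|L|.
Proof.
move=> vL; rewrite -sum_subsets mulr_sumr.
rewrite (reindex_onto (fun B => v |: B) (fun B => B :\ v)) /=; last first.
  by move=> B /andP[vB _]; rewrite setD1K.
apply: eq_big => [B|B].
  rewrite !inE eqxx /=; case: (boolP (v \in B)) => vB.
    rewrite (negbTE (contraNN (fun h => subsetP h v vB) vL)).
    apply/negbTE/negP=> /andP[_ /eqP h].
    by move/setP/(_ v): h; rewrite !inE eqxx vB.
  rewrite setU1K // eqxx andbT; apply/idP/idP => h.
    apply/subsetP=> w wB; have := subsetP h w; rewrite !inE wB orbT => /(_ isT).
    by case/orP=> // /eqP wv; rewrite -wv wB in vB.
  exact: setUS.
case/andP=> _ /eqP h.
have vB : v \notin B by rewrite -h !inE eqxx.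
by rewrite cardsU1 vB add1n exprS.
Qed.

(** * Splitting supports into old and added vertices *)

Section Split.
Variables (V W : finType) (t : int) (N : V -> {set V}) (L : V -> {set W}).
Hypothesis L_disj : forall u v b, b \in L u -> b \in L v -> u = v.

(** The pairs with empty second component give the first sum. Otherwise [L_disj] makes the centre
    unique, and the nonempty subsets of [L v] contribute [(1 + t) ^+ #|L v| - 1]. *)
Lemma sum_centered :
  \sum_(p : {set V} * {set W} |
      [exists v in p.1, (p.1 \subset N v) && (p.2 \subset L v)])
    t ^+ (#|p.1| + #|p.2|) =
  \sum_(A : {set V} | [exists v in A, A \subset N v]) t ^+ #|A| +
  \sum_v (\sum_(A : {set V} | (v \in A) && (A \subset N v)) t ^+ #|A|) *
         ((1 + t) ^+ #|L v| - 1).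
Proof.
rewrite big_mkcond -(pair_bigA _ (fun (A : {set V}) (B : {set W}) =>
  if [exists v in A, (A \subset N v) && (B \subset L v)]
  then t ^+ (#|A| + #|B|) else 0)) /=.
have -> : \sum_v (\sum_(A : {set V} | (v \in A) && (A \subset N v)) t ^+ #|A|) *
         ((1 + t) ^+ #|L v| - 1) =
  \sum_(A : {set V}) \sum_v if (v \in A) && (A \subset N v) then
     t ^+ #|A| * ((1 + t) ^+ #|L v| - 1) else 0.
  rewrite exchange_big /=; apply: eq_bigr => v _.
  by rewrite mulr_suml big_mkcond.
rewrite [X in _ = X + _]big_mkcond -big_split /=; apply: eq_bigr => A _.
rewrite (bigD1 set0) //= cards0 addn0; congr (_ + _).
  by congr (if _ then _ else _); apply: eq_existsb => v; rewrite sub0set andbT.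
(* Any element [b] of [B] determines the centre, so at most one [v] contributes to the inner sum. *)
transitivity (\sum_(B : {set W} | B != set0) \sum_v
  if [&& v \in A, A \subset N v & B \subset L v] then t ^+ (#|A| + #|B|) else 0).
  apply: eq_bigr => B /set0Pn[b bB]; case: ifPn => [/exists_inP[v vA /andP[AN BL]]|].
    rewrite (bigD1 v) //= vA AN BL big1 ?addr0 // => u uv.
    case: ifP => // /and3P[_ _ BLu]; case/eqP: uv.
    exact: L_disj (subsetP BLu b bB) (subsetP BL b bB).
  move=> h; rewrite big1 // => v _; case: ifP => // /and3P[vA AN BL].
  by case/exists_inP: h; exists v; rewrite ?AN.
rewrite exchange_big; apply: eq_bigr => v _ /=.
case: ifP => [/andP[-> ->]|h]; last first.
  by rewrite big1 // => B _; rewrite andbA h.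
rewrite /= -sum_subsets [X in _ * (X - 1)](bigD1 set0) ?sub0set //=.
rewrite cards0 expr0 [X in _ * X]addrC addKr mulr_sumr.
rewrite -big_mkcondr; apply: eq_big => [B|B _]; first by rewrite andbC.
by rewrite exprD.
Qed.

Lemma sum_sets_sum (F : pred ({set V} * {set W})) :
  \sum_(s : {set V + W} | F (inl @^-1: s, inr @^-1: s)) t ^+ #|s| =
  \sum_(p | F p) t ^+ (#|p.1| + #|p.2|).
Proof.
pose g (p : {set V} * {set W}) : {set V + W} :=
  [set w | match w with inl v => v \in p.1 | inr b => b \in p.2 end].
pose f (s : {set V + W}) : {set V} * {set W} := (inl @^-1: s, inr @^-1: s).
have gK : cancel g f.
  by case=> A B; congr (_, _); apply/setP=> w; rewrite !inE.
have fK : cancel f g by move=> s; apply/setP=> -[v|b]; rewrite !inE.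
rewrite (reindex g) /=; last by exists f => ? _; rewrite ?fK ?gK.
apply: eq_big => [p|[A B] _]; first by rewrite -[in RHS](gK p).
congr (_ ^+ _); rewrite -(card_imset (mem A) (@inl_inj V W)).
rewrite -(card_imset (mem B) (@inr_inj V W)).
have dis : [set inl v | v in A] :&: [set inr b | b in B] = set0 :> {set V + W}.
  apply/setP=> w; rewrite !inE; apply/negbTE/negP=> /andP[/imsetP[a _ ->]].
  by case/imsetP.
rewrite -cardsUI dis cards0 addn0; congr #|pred_of_set _|.
apply/setP=> -[v|b]; rewrite !inE.
  rewrite mem_imset ?inE; last exact: inl_inj.
  by apply/idP/orP=> [->|[//|/imsetP[]//]]; left.
rewrite orbC mem_imset ?inE; last exact: inr_inj.
by apply/idP/orP=> [->|[//|/imsetP[]//]]; left.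
Qed.

End Split.

(** * Counting points through the affine cone *)

Section Points.
Variables (k : finFieldType) (G : loose_graph).
Hypothesis no_empty : forall e : edge G, ends e != set0.

Local Notation t := #|k|.-1.

(* The affine cone over F_points without its apex. *)
Definition cone : {set coords k G} :=
  [set X : coords k G | [exists v : vert G, (X (inl v) != 0) &&
    [forall w, (w != inl v) && ~~ @adj (completion G) (inl v) w
       ==> (X w == 0)]]].

Lemma proj_pt_id (X : coords k G) : X \in proj_pt X.
Proof.
by apply/imsetP; exists 1; rewrite ?inE ?oner_eq0 //;
  apply/ffunP=> w; rewrite ffunE mul1r.
Qed.

Lemma proj_pt_eq (X Y : coords k G) : Y \in proj_pt X -> proj_pt Y = proj_pt X.
Proof.
case/imsetP=> c; rewrite inE => c0 ->; apply/setP=> Z.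
apply/imsetP/imsetP=> -[d]; rewrite inE => d0 ->.
  exists (d * c); first by rewrite inE mulf_neq0.
  by apply/ffunP=> w; rewrite !ffunE mulrA.
exists (d / c); first by rewrite inE mulf_neq0 ?invr_eq0.
by apply/ffunP=> w; rewrite !ffunE mulrA divfK.
Qed.

Lemma card_proj_pt (X : coords k G) w : X w != 0 -> #|proj_pt X| = t.
Proof.
move=> Xw; rewrite card_in_imset.
  by rewrite -(cardC1 (0 : k)); apply: eq_card => c; rewrite !inE.
move=> c d _ _ /ffunP/(_ w); rewrite !ffunE; exact: mulIf.
Qed.

Lemma cone_closed (X Y : coords k G) : X \in cone -> Y \in proj_pt X -> Y \in cone.
Proof.
rewrite !inE => /existsP[v /andP[Xv /forallP h]] /imsetP[c]; rewrite inE => c0 ->.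
apply/existsP; exists v; rewrite ffunE mulf_neq0 //=; apply/forallP=> w.
by apply/implyP=> /(implyP (h w))/eqP Xw; rewrite ffunE Xw mulr0.
Qed.

(** Without empty edges there are no torus pieces, and the affine pieces together are the image of
    the cone. *)
Lemma F_points_cone : F_points k G = [set proj_pt X | X in cone].
Proof.
rewrite /F_points [X in _ :|: X]big1 ?setU0 => [|e]; last first.
  by rewrite (negbTE (no_empty e)).
apply/setP=> p; apply/bigcupP/imsetP => [[v _ /imsetP[X]]|[X]]; rewrite inE.
  by move=> h ->; exists X; rewrite // inE; apply/existsP; exists v.
by case/existsP=> v h ->; exists v => //; apply/imsetP; exists X; rewrite ?inE.
Qed.

(** The scaling classes partition the cone, and each has [#|k|.-1] elements. *)
Lemma card_cone : (nb_points k G * t)%N = #|cone|.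
Proof.
rewrite /nb_points F_points_cone; apply/esym.
apply: card_uniform_partition => [p /imsetP[X]|].
  by rewrite inE => /existsP[v /andP[Xv _]] ->; apply: card_proj_pt Xv.
apply/and3P; split.
- rewrite eqEsubset; apply/andP; split; last first.
    apply/subsetP=> X Xc; apply/bigcupP; exists (proj_pt X).
      exact: imset_f.
    exact: proj_pt_id.
  by apply/bigcupsP=> p /imsetP[X Xc ->]; apply/subsetP=> Y; apply: cone_closed.
- apply/trivIsetP=> _ _ /imsetP[X _ ->] /imsetP[Y _ ->]; apply: contraR.
  case/pred0Pn=> Z /andP[ZX ZY].
  by rewrite -(proj_pt_eq ZX) -(proj_pt_eq ZY).
- by apply/imsetP=> -[X _ /setP/(_ X)]; rewrite proj_pt_id inE.
Qed.

(** A vector with support [s] is a free choice of a nonzero scalar at each element of [s];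
    [pffun_on] counts these with default value 0. *)
Lemma card_support (W : finType) (s : {set W}) :
  #|[set X : {ffun W -> k} | [set w | X w != 0] == s]| = (t ^ #|s|)%N.
Proof.
rewrite -(cardC1 (0 : k)) -(card_pffun_on 0 (mem s) (predC1 (0 : k))).
apply: eq_card => X; rewrite inE; apply/eqP/pffun_onP => [<-|[h1 h2]].
  split; first by apply/supportP=> w; rewrite inE negbK => /eqP.
  by move=> y /imageP[w]; rewrite inE => Xw ->; rewrite inE.
apply/setP=> w; rewrite inE; apply/idP/idP=> [Xw|ws]; first exact: (subsetP h1).
by have := h2 (X w) (image_f _ ws); rewrite inE.
Qed.

Definition loose_ends (v : vert G) : {set added_vert G} := [set a | inc v (tag a)].

Definition nloose (v : vert G) : nat := #|[set e : edge G | ends e == [set v]]|.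

(** An element of ['I_(2 - #|ends e|)] exists only if [e] has at most one vertex. *)
Lemma ends_added (a : added_vert G) v : inc v (tag a) -> ends (tag a) = [set v].
Proof.
case: a => e i /= ve; apply/esym/eqP.
rewrite eqEcard sub1set inE ve cards1 /=.
by have := leq_ltn_trans (leq0n _) (ltn_ord i); rewrite subn_gt0 ltnS.
Qed.

Lemma loose_ends_disj u v b : b \in loose_ends u -> b \in loose_ends v -> u = v.
Proof.
by rewrite !inE => /ends_added bu /ends_added; rewrite bu => /set1_inj.
Qed.

(** A loose edge with exactly one vertex receives [2 - 1] added vertices, so [tag] is a bijection
    onto the loose edges at [v]. *)
Lemma card_loose_ends v : #|loose_ends v| = nloose v.
Proof.
have injt : {in loose_ends v &, injective (fun a : added_vert G => tag a)}.
  move=> [e i] [f j]; rewrite !inE /= => ie jf ef; subst f.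
  congr (Tagged _ _); apply: ord_inj.
  have c1 : #|ends e| = 1%N.
    by rewrite (@ends_added (Tagged (fun e : edge G => 'I_(2 - #|ends e|)) i) v ie) cards1.
  have val0 (m : 'I_(2 - #|ends e|)) : val m = 0%N.
    by case: m => m /=; rewrite c1 => /[!ltnS]; rewrite leqn0 => /eqP.
  by rewrite -!/(val _) !val0.
rewrite -(card_in_imset injt); apply: eq_card => e; rewrite inE.
apply/imsetP/eqP=> [[a]|ev]; first by rewrite inE => /ends_added ? ->.
have i0 : (0 < 2 - #|ends e|)%N by rewrite ev cards1.
exists (Tagged (fun e : edge G => 'I_(2 - #|ends e|)) (Ordinal i0)) => //.
by rewrite inE /=; move/setP/(_ v): ev; rewrite !inE eqxx.
Qed.

Definition star_support (p : {set vert G} * {set added_vert G}) :=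
  [exists v in p.1, (p.1 \subset v |: nbrs (@adj G) v) && (p.2 \subset loose_ends v)].

(** In the completion, [v] is adjacent to an added vertex [a] exactly when [v] lies on [tag a]; the
    vanishing condition thus splits into one on old and one on added vertices. *)
Lemma cone_support (X : coords k G) :
  (X \in cone) =
  star_support (inl @^-1: [set w | X w != 0], inr @^-1: [set w | X w != 0]).
Proof.
rewrite inE; apply: eq_existsb => v; rewrite !inE; congr (_ && _).
apply/forallP/andP=> [h|[/subsetP hV /subsetP hA] [w|a]].
- split; apply/subsetP=> w; rewrite !inE; apply: contraR.
    by rewrite negb_or; apply: (implyP (h (inl w))).
  move=> vw; apply: (implyP (h (inr w))); rewrite /= negb_exists.
  by apply/forallP=> f; apply: contra vw => /andP[vf /eqP ->].
- apply/implyP=> wv; have := hV w; rewrite !inE; case: eqP => //= _ /(_ isT).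
  by rewrite -[_ || _]negbK negb_or wv.
- apply/implyP=> wv; have := hA a; rewrite !inE; case: eqP => //= _ /(_ isT) va.
  case/existsP: wv; exists (tag a) => /=; rewrite va; exact: eqxx.
Qed.

(** The vectors of the cone are sorted by support, and the admissible supports are then summed by
    [sum_centered]. *)
Lemma nb_points_formula :
  (nb_points k G)%:Z * t%:Z = star_count t%:Z (@adj G) nloose.
Proof.
rewrite -PoszM card_cone.
transitivity (\sum_(s : {set vert G + added_vert G} |
     star_support (inl @^-1: s, inr @^-1: s)) t%:Z ^+ #|s|).
  rewrite -sum1_card.
  rewrite (partition_big (fun X : coords k G => [set w | X w != 0])
    (fun s => star_support (inl @^-1: s, inr @^-1: s))) /= => [|X]; last first.
    by rewrite cone_support.
  rewrite (big_morph Posz (id1 := 0) (op1 := +%R)) //.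
  apply: eq_bigr => s Fs; rewrite sum1dep_card -rmorphXn natrXE -card_support.
  congr (Posz _); apply: eq_card => X; rewrite inE [in RHS]inE andb_idl // => /eqP Xs.
  by rewrite cone_support Xs.
rewrite sum_sets_sum (sum_centered _ _ loose_ends_disj).
congr (_ + _); apply: eq_bigr => v _; rewrite sum_subsets_mem ?card_loose_ends //.
by rewrite inE /adj eqxx.
Qed.
End Points.

Lemma eq_star_count (V : finType) (t : int) (r r' : rel V) l l' :
  r =2 r' -> l =1 l' -> star_count t r l = star_count t r' l'.
Proof.
move=> rr ll; have nr v : nbrs r v = nbrs r' v by apply/setP=> w; rewrite !inE rr.
rewrite /star_count; congr (_ + _); last by apply: eq_bigr => v _; rewrite nr ll.
by apply: eq_bigl => A; apply: eq_existsb => v; rewrite nr.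
Qed.

(** * Locality of the star count *)

Section Restriction.
Variables (V : finType) (t : int) (S : {set V}).
Local Notation sV := {v : V | v \in S}.

Lemma imset_val_sub (A : {set sV}) : val @: A \subset S.
Proof. by apply/subsetP=> _ /imsetP[u _ ->]; apply: valP. Qed.

Lemma val_preimsetK (A : {set V}) : A \subset S -> val @: ((val : sV -> V) @^-1: A) = A.
Proof.
move=> AS; apply/setP=> v; apply/imsetP/idP=> [[u]|vA]; first by rewrite inE => ? ->.
by exists (Sub v (subsetP AS v vA)); rewrite ?inE SubK.
Qed.

Lemma preimset_valK (A : {set sV}) : (val : sV -> V) @^-1: (val @: A) = A.
Proof. by apply/setP=> u; rewrite inE mem_imset //; apply: val_inj. Qed.

Lemma starlike_restrict (r : rel V) (A : {set sV}) :
  starlike (relpre val r) A = starlike r (val @: A).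
Proof.
have sub_eq (u : sV) :
    (A \subset u |: nbrs (relpre val r) u) =
    (val @: A \subset val u |: nbrs r (val u)).
  by rewrite sub_imset_pre; apply: eq_subset_r => w; rewrite !inE.
apply/exists_inP/exists_inP=> [[u uA h]|[_ /imsetP[u uA ->] h]].
  by exists (val u); [apply: imset_f | rewrite -sub_eq].
by exists u; rewrite ?sub_eq.
Qed.

Lemma star_sum_restrict (r : rel V) :
  \sum_(A : {set sV} | starlike (relpre val r) A) t ^+ #|A| =
  \sum_(A : {set V} | starlike r A && (A \subset S)) t ^+ #|A|.
Proof.
rewrite (reindex_onto (fun A : {set sV} => val @: A) (fun A => val @^-1: A)) /=.
  apply: eq_big => A; last by rewrite card_imset //; apply: val_inj.
  by rewrite preimset_valK eqxx andbT imset_val_sub andbT starlike_restrict.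
by move=> A /andP[_ AS]; apply: val_preimsetK.
Qed.

Lemma card_nbrs_restrict (r : rel V) (u : sV) :
  #|nbrs (relpre val r) u| = #|nbrs r (val u) :&: S|.
Proof.
rewrite -[in RHS](val_preimsetK (subsetIr _ S)) card_imset; last exact: val_inj.
by apply: eq_card => w; rewrite !inE (valP w) andbT.
Qed.

Variables (r r' : rel V) (l l' : V -> nat) (D : {set V}).
Hypotheses (nbrsD : forall v, v \notin D -> nbrs r v = nbrs r' v)
           (lD : forall v, v \notin D -> l v = l' v)
           (DS : D \subset S)
           (rS : forall v, v \in D -> nbrs r v \subset S)
           (r'S : forall v, v \in D -> nbrs r' v \subset S).

(** A star centred in [D] lies inside [S], so a set not contained in [S] can only be centred outside
    [D], where both relations have the same neighbours. *)
Lemma starlike_notsub (A : {set V}) : ~~ (A \subset S) -> starlike r A = starlike r' A.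
Proof.
move=> AS; apply: eq_existsb => v; congr (_ && _).
case: (boolP (v \in D)) => vD; last by rewrite nbrsD.
have out (q : rel V) : nbrs q v \subset S -> (A \subset v |: nbrs q v) = false.
  move=> qS; apply: contraNF AS => /subset_trans; apply.
  by rewrite subUset sub1set qS (subsetP DS).
by rewrite !out ?rS ?r'S.
Qed.

(** [D] is where the data may change and [S] contains its closed neighbourhoods. Star-like sets not
    contained in [S] cancel by [starlike_notsub], and so do the loose terms at vertices outside
    [D]. *)
Lemma star_count_local :
  star_count t r l - star_count t r' l' =
  star_count t (relpre val r) (fun u : sV => l (val u)) -
  star_count t (relpre val r') (fun u : sV => l' (val u)).
Proof.
rewrite /star_count !star_sum_restrict.
rewrite (bigID (fun A : {set V} => A \subset S)) /=.
rewrite [X in _ - (X + _)](bigID (fun A : {set V} => A \subset S)) /=.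
have -> : \sum_(A : {set V} | starlike r A && ~~ (A \subset S)) t ^+ #|A| =
          \sum_(A : {set V} | starlike r' A && ~~ (A \subset S)) t ^+ #|A|.
  by apply: eq_bigl => A; case: (boolP (A \subset S)) => AS;
    rewrite ?andbF // starlike_notsub.
have loose_eq : \sum_v loose_term t #|nbrs r v| (l v) -
                \sum_v loose_term t #|nbrs r' v| (l' v) =
    \sum_(u : sV) loose_term t #|nbrs (relpre val r) u| (l (val u)) -
    \sum_(u : sV) loose_term t #|nbrs (relpre val r') u| (l' (val u)).
  rewrite -!sumrB (bigID (mem S)) /= [X in _ + X]big1 ?addr0 => [|v vS]; last first.
    have vD : v \notin D by apply: contra vS; apply: subsetP.
    by rewrite nbrsD // lD // subrr.
  rewrite big_sub.
  apply: eq_bigr => u _; rewrite !card_nbrs_restrict.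
  (* Outside [D] restriction may lose neighbours, but the same ones for [r] and [r']; inside [D] it
     loses none. *)
  case: (boolP (val u \in D)) => uD; last by rewrite nbrsD // lD // !subrr.
  by rewrite (setIidPl (rS uD)) (setIidPl (r'S uD)).
have arith (a b c p p' s s' : int) :
  p - p' = s - s' -> (a + c + p) - (b + c + p') = (a + s) - (b + s') by lia.
exact: arith loose_eq.
Qed.
End Restriction.

(** * Adjacency, unit balls and induced graphs *)

(** An edge has at most two vertices, so one incident with [u] and [v] distinct has no others. This
    form through [ends] transfers to the derived graphs. *)
Lemma adjE (G : loose_graph) (u v : vert G) :
  adj u v = (u != v) && [exists e : edge G, ends e == [set u; v]].
Proof.
rewrite /adj; case: (altP (u =P v)) => //= uv; apply: eq_existsb => e.
apply/andP/eqP=> [[ue ve]|/setP h]; last first.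
  by have := h u; have := h v; rewrite !inE !eqxx orbT.
by apply/esym/eqP; rewrite eqEcard cards2 uv ends_le2 andbT subUset !sub1set !inE ue.
Qed.

(** With at least two vertices, the search in [gdist] tries length 0, which finds [c], and then
    length 1, which finds its neighbours; all later answers exceed 1. *)
Lemma cball1 (G : loose_graph) (c : vert G) :
  (1 < #|vert G|)%N -> cball c 1 = c |: nbrs (@adj G) c.
Proof.
move=> V2; apply/setP=> v; rewrite !inE /gdist -(subnKC V2) /=.
case: existsP => [[p /andP[_ /eqP <-]]|h]; first by rewrite [p]tuple0 eqxx.
case: eqP => [vc|_] /=.
  by case: h; exists [tuple]; rewrite /= vc eqxx.
case: existsP => [[p]|h'].
  by case/tupleP: p => w p; rewrite [p]tuple0 /= andbT => /andP[cw /eqP <-].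
by apply/esym/negbTE/negP=> cv; case: h'; exists [tuple v]; rewrite /= cv eqxx.
Qed.

Section InducedGraph.
Variables (G : loose_graph) (S : {set vert G}).

Lemma ends_induced (f : edge (induced S)) : ends (val f) = val @: ends f.
Proof.
have -> : ends f = val @^-1: ends (val f) by apply/setP=> u; rewrite !inE.
by rewrite val_preimsetK ?(valP f).
Qed.

Lemma induced_endsP (A : {set vert (induced S)}) :
  [exists f : edge (induced S), ends f == A] =
  [exists f : edge G, ends f == val @: A].
Proof.
apply/existsP/existsP=> [[f /eqP <-]|[f fA]].
  by exists (val f); rewrite ends_induced.
have fS : ends f \subset S by rewrite (eqP fA) imset_val_sub.
exists (Sub f fS); rewrite -(inj_eq (imset_inj val_inj)) -ends_induced SubK.
exact: fA.
Qed.

Lemma adj_induced (u v : vert (induced S)) : adj u v = adj (val u) (val v).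
Proof. by rewrite !adjE induced_endsP imsetU1 imset_set1. Qed.

(** A loose edge at a vertex of [S] has all its vertices in [S], hence is kept. *)
Lemma nloose_induced (u : vert (induced S)) : nloose u = nloose (val u).
Proof.
rewrite /nloose -(card_imset _ val_inj); congr #|pred_of_set _|.
apply/setP=> f; rewrite inE; apply/imsetP/eqP=> [[g]|fu].
  by rewrite inE => /eqP gu ->; rewrite ends_induced gu imset_set1.
have fS : ends f \subset S by rewrite fu sub1set (valP u).
exists (Sub f fS); rewrite ?SubK // inE.
by rewrite -(inj_eq (imset_inj val_inj)) -ends_induced SubK fu imset_set1.
Qed.

Lemma induced_no_empty :
  (forall f : edge G, ends f != set0) ->
  forall f : edge (induced S), ends f != set0.
Proof.
by move=> h f; apply: contra (h (val f)) => /eqP f0; rewrite ends_induced f0 imset0.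
Qed.

End InducedGraph.

(** * Effect of resolution on adjacency and loose edges *)

Section ResolvedGraph.
Variables (G : loose_graph) (e : edge G) (x y : vert G).
Hypothesis exy : edge_on e x y.
Local Notation Gxy := (resolve e x y).

Lemma ends_resolve (f : edge Gxy) : ends f =
  match f with inl f => ends (val f) | inr b => [set if b then x else y] end.
Proof. by apply/setP=> v; case: f => [f|[]]; rewrite !inE. Qed.

(** The two new edges have one vertex each, so the bound on [#|A|] excludes them. *)
Lemma resolve_endsP (A : {set vert G}) : (1 < #|A|)%N ->
  [exists f : edge Gxy, ends f == A] =
  [exists f : edge G, (f != e) && (ends f == A)].
Proof.
move=> A2; apply/existsP/existsP=> [[f]|[f /andP[fe fA]]]; last first.
  by exists (inl (Sub f fe)); rewrite ends_resolve SubK.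
rewrite ends_resolve; case: f => [f fA|b /eqP bA]; last by rewrite -bA cards1 in A2.
by exists (val f); rewrite (valP f).
Qed.

Lemma adj_resolve (u v : vert G) : @adj Gxy u v =
  (u != v) && [exists f : edge G, (f != e) && (ends f == [set u; v])].
Proof.
by rewrite adjE; case: (altP (u =P v)) => //= uv; rewrite resolve_endsP // cards2 uv.
Qed.

Lemma adj_resolve_sub (u v : vert G) : @adj Gxy u v -> adj u v.
Proof.
rewrite adj_resolve adjE => /andP[-> /existsP[f /andP[_ h]]] /=.
by apply/existsP; exists f.
Qed.

Lemma adj_resolve_id (u v : vert G) :
  [set u; v] != [set x; y] -> @adj Gxy u v = adj u v.
Proof.
move=> uvxy; rewrite adj_resolve adjE; congr (_ && _); apply: eq_existsb => f.
rewrite andb_idl // => /eqP fuv; apply: contraNneq uvxy => fe.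
by rewrite -fuv fe; case/andP: exy.
Qed.

Lemma nbrs_resolve_id (v : vert G) :
  v \notin [set x; y] -> nbrs (@adj G) v = nbrs (@adj Gxy) v.
Proof.
move=> vxy; apply/setP=> w; rewrite !inE adj_resolve_id //.
by apply: contraNneq vxy => <-; rewrite !inE eqxx.
Qed.

(** The deleted edge has two vertices, so every old loose edge survives; [x] and [y] each gain a new
    one. *)
Lemma nloose_resolve (v : vert G) :
  @nloose Gxy v = (nloose v + (v \in [set x; y]))%N.
Proof.
have [xy /eqP ends_e] := andP exy.
rewrite /nloose.
have -> : [set f : edge Gxy | ends f == [set v]] =
   [set inl f | f : {f : edge G | f != e} & ends (val f) == [set v]] :|:
   [set inr b | b : bool & (if b then x else y) == v].
  apply/setP=> f; rewrite inE ends_resolve [RHS]inE.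
  case: f => [f|b].
    rewrite mem_imset ?inE; last exact: inl_inj.
    by apply/idP/orP=> [->|[//|/imsetP[]//]]; left.
  rewrite orbC mem_imset ?inE; last exact: inr_inj.
  rewrite (inj_eq set1_inj).
  by apply/idP/orP=> [->|[//|/imsetP[]//]]; left.
rewrite cardsU disjoint_setI0 ?cards0 ?subn0; last first.
  by apply/pred0P=> f; apply/negbTE/negP=> /andP[/imsetP[a _ ->] /imsetP[]].
rewrite !card_imset; [|exact: inr_inj|exact: inl_inj].
congr (_ + _)%N.
  rewrite -(card_imset _ val_inj); congr #|pred_of_set _|; apply/setP=> f.
  rewrite inE; apply/imsetP/eqP=> [[g]|fv]; first by rewrite inE => /eqP gv ->.
  have fe : f != e.
    apply/eqP=> fe; move: fv; rewrite fe ends_e => /(congr1 (fun A => #|pred_of_set A|)).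
    by rewrite cards2 xy cards1.
  by exists (Sub f fe); rewrite ?SubK // inE SubK fv.
(* Since [x != y], at most one of the two booleans counts for a given [v]. *)
rewrite -sum1_card big_mkcond big_bool /= !inE ![v == _]eq_sym.
by case: (altP (x =P v)) => [<-|_]; rewrite 1?eq_sym ?(negbTE xy) //; case: (_ == _).
Qed.

Lemma resolve_no_empty :
  (forall f : edge G, ends f != set0) -> forall f : edge Gxy, ends f != set0.
Proof.
move=> h f; rewrite ends_resolve; case: f => [f|b]; first exact: h.
by apply/set0Pn; exists (if b then x else y); rewrite inE.
Qed.
End ResolvedGraph.

(** * Reduced graphs, connectedness and simplicity *)

Section ReducedGraph.
Variable G : loose_graph.
Local Notation R := (reduced G).

Lemma ends_reduced (f : edge R) : ends f = ends (val f).
Proof. by apply/setP=> v; rewrite !inE. Qed.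

Lemma adj_reduced (u v : vert G) : @adj R u v = adj u v.
Proof.
rewrite !adjE; case: (altP (u =P v)) => //= uv; apply/existsP/existsP=> -[f].
  by rewrite ends_reduced => fuv; exists (val f).
move=> fuv; have fl : ~~ loose f by rewrite /loose (eqP fuv) cards2 uv.
by exists (Sub f fl); rewrite ends_reduced SubK.
Qed.

Lemma nloose_reduced (v : vert G) : @nloose R v = 0%N.
Proof.
apply/eqP; rewrite cards_eq0; apply/eqP/setP=> f; rewrite !inE ends_reduced.
by apply: contraNF (valP f) => /eqP fv; rewrite /loose fv cards1.
Qed.

Lemma reduced_no_empty (f : edge R) : ends f != set0.
Proof.
by rewrite ends_reduced; apply: contra (valP f) => /eqP f0; rewrite /loose f0 cards0.
Qed.

Lemma reduced_edge_on (e : edge G) (x y : vert G) (exy : edge_on e x y) :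
  @edge_on R (reduced_edge exy) x y.
Proof. by rewrite /edge_on ends_reduced. Qed.

End ReducedGraph.

(** The incidence path from [f] to [x] must begin with a vertex on [f]. *)
Lemma connected_no_empty (G : loose_graph) (x : vert G) :
  connected_graph G -> forall f : edge G, ends f != set0.
Proof.
move=> /forallP conn f; have /forallP/(_ (inl x))/connectP := conn (inr f).
case=> -[|[v|g] p] //= /andP[vf _] _.
by apply/set0Pn; exists v; rewrite inE.
Qed.

(** Another edge on [x] and [y] would be parallel to [e], hence equal to it. *)
Lemma simple_adj_resolve (G : loose_graph) (e : edge G) (x y : vert G) :
  edge_on e x y -> simple_graph G -> @adj (resolve e x y) x y = false.
Proof.
move=> exy sG; rewrite adj_resolve; apply/negbTE/negP=> /andP[xy /existsP[f /andP[fe]]].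
have /andP[_ /eqP <-] := exy; move=> /eqP fe'; case/eqP: fe; apply: (sG _ _ _ fe').
by rewrite /loose fe'; apply: edge_on_nonloose exy.
Qed.

Lemma nbrs_resolve_simple (G : loose_graph) (e : edge G) (x y v : vert G) :
  edge_on e x y -> simple_graph G -> v \in [set x; y] ->
  #|nbrs (@adj G) v| = #|nbrs (@adj (resolve e x y)) v|.+1.
Proof.
move=> exy sG vxy; have /andP[xy /eqP ends_e] := exy.
have nxy := simple_adj_resolve exy sG.
have adj_sym (H : loose_graph) : symmetric (@adj H).
  by move=> u w; rewrite !adjE eq_sym setUC.
have axy : @adj G x y by rewrite adjE xy; apply/existsP; exists e; rewrite ends_e.
(* The argument is symmetric in the two ends: [u] loses exactly the neighbour [w]. *)
have main u w : [set u; w] = [set x; y] -> u != w -> adj u w ->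
    @adj (resolve e x y) u w = false ->
    #|nbrs (@adj G) u| = #|nbrs (@adj (resolve e x y)) u|.+1.
  move=> uw_xy uw auw nuw; rewrite (cardsD1 w) inE auw add1n; congr _.+1.
  apply: eq_card => z; rewrite !inE; case: eqP => [->|/eqP zw] //=.
  rewrite (adj_resolve_id exy) // -uw_xy; apply: contraNneq zw => h.
  move/setP/(_ w): (h); rewrite !inE eqxx orbT eq_sym [w == z]eq_sym (negbTE uw) /= => ->.
  by [].
case/set2P: vxy => ->; first by apply: (main x y).
by apply: (main y x); rewrite ?(setUC [set y]) 1?eq_sym // adj_sym.
Qed.

(** * The difference formula and its reduced version *)

Section Principle.
Variables (k : finFieldType).
Local Notation t := #|k|.-1.

Lemma nb_points_sub (G H : loose_graph) :
  (forall f : edge G, ends f != set0) -> (forall f : edge H, ends f != set0) ->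
  ((nb_points k G)%:Z - (nb_points k H)%:Z) * t%:Z =
  star_count t%:Z (@adj G) (@nloose G) - star_count t%:Z (@adj H) (@nloose H).
Proof. by move=> hG hH; rewrite mulrBl !nb_points_formula. Qed.

Lemma card_units_neq0 : t%:Z != 0.
Proof. by rewrite (cardD1 0) (cardD1 1) !inE oner_eq0. Qed.

(** Absence of empty edges passes to induced and resolved graphs, whereas resolving a bridge
    destroys connectedness. After multiplication by [#|k|.-1] the claim is an instance of
    [star_count_local]. *)
Lemma affection_principle (G : loose_graph) (e : edge G) (x y : vert G) :
  (forall f : edge G, ends f != set0) -> edge_on e x y ->
  (nb_points k G)%:Z - (nb_points k (resolve e x y))%:Z =
  (nb_points k (@induced G (Pxy x y)))%:Z -
  (nb_points k (@induced (resolve e x y) (@Pxy G x y)))%:Z.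
Proof.
move=> h exy; apply: (mulIf card_units_neq0).
have hr := resolve_no_empty (e := e) (x := x) (y := y) h.
rewrite !nb_points_sub //; do ?exact: induced_no_empty.
have V2 : (1 < #|vert G|)%N.
  have /andP[xy _] := exy; have := subset_leq_card (subsetT [set x; y]).
  by rewrite cards2 xy cardsT.
have nS v : v \in [set x; y] -> nbrs (@adj G) v \subset Pxy x y.
  rewrite /Pxy !cball1 //; case/set2P=> ->.
    by rewrite -setUA setUCA subsetUl.
  by rewrite setUC -setUA setUCA subsetUl.
(* Resolution changes neighbours and loose edges only at [x] and [y], whose closed neighbourhoods
   make up [Pxy x y]. *)
rewrite (@star_count_local _ t%:Z (@Pxy G x y) _ _ _ _ [set x; y]).
- congr (_ - _); apply: eq_star_count => u *; rewrite ?adj_induced ?nloose_induced //.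
- exact: nbrs_resolve_id.
- by move=> v vxy; rewrite (nloose_resolve exy) (negbTE vxy) addn0.
- by rewrite /Pxy !cball1 // subUset !sub1set !inE !eqxx ?orbT.
- exact: nS.
- move=> v /nS; apply: subset_trans; apply/subsetP=> w; rewrite !inE.
  exact: adj_resolve_sub.
Qed.

(** Only the differences agree, not the counts themselves: adjacency ignores loose edges, so the
    star-like sums coincide and just the loose terms need comparing. *)
Lemma nb_points_reduced (G : loose_graph) (e : edge G) (x y : vert G)
    (exy : edge_on e x y) :
  (forall f : edge G, ends f != set0) -> simple_graph G ->
  (nb_points k G)%:Z - (nb_points k (resolve e x y))%:Z =
  (nb_points k (reduced G))%:Z -
  (nb_points k (@resolve (reduced G) (reduced_edge exy) x y))%:Z.
Proof.
move=> h sG; apply: (mulIf card_units_neq0); have h' := @reduced_no_empty G.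
have exyR := reduced_edge_on exy.
rewrite !nb_points_sub //; do ?exact: resolve_no_empty.
have adjR' : @adj (resolve e x y) =2
    @adj (@resolve (reduced G) (reduced_edge exy) x y).
  move=> u v; rewrite !adj_resolve; case: (altP (u =P v)) => //= uv.
  apply/existsP/existsP=> -[f]; last first.
    rewrite ends_reduced -(inj_eq val_inj) => fuv; by exists (val f).
  move=> /andP[fe fuv]; have fl : ~~ loose f by rewrite /loose (eqP fuv) cards2 uv.
  by exists (Sub f fl); rewrite ends_reduced -(inj_eq val_inj) SubK fe.
rewrite (eq_star_count _ (@adj_reduced G) (@nloose_reduced G)).
rewrite -(eq_star_count _ adjR' (fun v => erefl _)) /star_count.
have loose_eq : \sum_v loose_term t%:Z #|nbrs (@adj G) v| (nloose v) -
    \sum_v loose_term t%:Z #|nbrs (@adj (resolve e x y)) v| (@nloose (resolve e x y) v) =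
    \sum_v loose_term t%:Z #|nbrs (@adj G) v| 0 -
    \sum_v loose_term t%:Z #|nbrs (@adj (resolve e x y)) v|
      (@nloose (@resolve (reduced G) (reduced_edge exy) x y) v).
  rewrite -!sumrB; apply: eq_bigr => v _.
  rewrite (nloose_resolve exy) (nloose_resolve exyR) nloose_reduced.
  case: (boolP (v \in [set x; y])) => vxy; last first.
    by rewrite (nbrs_resolve_id exy) // !addn0 !subrr.
  (* Simplicity makes the number of neighbours drop by exactly one while one loose edge is gained,
     so the old loose edges cancel from the difference. *)
  by rewrite (nbrs_resolve_simple exy sG vxy) !addn1 loose_term_resolve.
have arith (a b p p' s s' : int) :
  p - p' = s - s' -> (a + p) - (b + p') = (a + s) - (b + s') by lia.
exact: arith loose_eq.
Qed.
End Principle.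

Theorem corollary11p8 (G : loose_graph) (e : edge G) (x y : vert G)
    (k : finFieldType) (G_conn : connected_graph G) (exy : edge_on e x y) :
  let Gxy := resolve e x y in
  let R := reduced G in
  let Rxy := @resolve R (reduced_edge exy) x y in
  ((nb_points k G)%:Z - (nb_points k Gxy)%:Z =
   (nb_points k (@induced G (@Pxy G x y)))%:Z
   - (nb_points k (@induced Gxy (@Pxy G x y)))%:Z)
  /\
  (simple_graph G ->
   (nb_points k G)%:Z - (nb_points k Gxy)%:Z =
   (nb_points k (@induced R (@Pxy R x y)))%:Z
   - (nb_points k (@induced Rxy (@Pxy R x y)))%:Z).
Proof.
have no_empty := connected_no_empty x G_conn.
split=> [|sG]; first exact: affection_principle.
(* The graph is reduced globally first; the local formula is then applied to the reduced graph. *)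
rewrite (nb_points_reduced k exy no_empty sG).
exact: affection_principle (@reduced_no_empty G) (reduced_edge_on exy).
Qed.
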